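(* Let $f:\mathbb{R}^n\to\mathbb{R}$ be a convex differentiable function possessing a minimizer $x^*$, whose gradient satisfies the Hölder condition for some $\nu\in[0,1]$ with some finite constant $M_\nu$. Let $\varepsilon>0$, $L_0>0$, $x_0\in\mathbb{R}^n$, let $\Theta\geq\frac12\|x_0-x^*\|^2$, and consider the sequences generated by the algorithm ULCM with input $f,L_0,x_0,\varepsilon$. For $m\geq1$ put $A_m=\alpha_m^2L_m$, $$l_m(u)=\sum_{i=1}^m\alpha_i\left(f(x_i)+\langle\nabla f(x_i),u-x_i\rangle\right),\qquad \hat f_m=\min_{u:\ \frac12\|z_0-u\|^2\leq\Theta}\frac{1}{A_m}l_m(u).$$ Then for every $m\ge1$ $$f(y_m)-f(x^* )\leq f(y_m)-\hat f_m\leq\frac{\varepsilon}{2}+\frac{\Theta}{A_m}.$$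
   Context: $\|\cdot\|$ is the Euclidean norm on $\mathbb{R}^n$. The gradient of $f$ satisfies the Hölder condition with exponent $\nu\in[0,1]$ and constant $M_\nu\ge 0$ if $\|\nabla f(x)-\nabla f(y)\|\leq M_\nu\|x-y\|^\nu$ for all $x,y\in\mathbb{R}^n$. Algorithm ULCM (Universal Linear Coupling Method). Input: $f$, initial value $L_0>0$, initial point $x_0\in\mathbb{R}^n$, accuracy $\varepsilon>0$. Set $y_0=z_0=x_0$, $\alpha_0=0$. For $k=0,1,2,\dots$: start with the trial value $L_{k+1}=L_k/2$ and repeat the following: - $\alpha_{k+1}=\frac{1}{2L_{k+1}}+\sqrt{\frac{1}{4L_{k+1}^2}+\alpha_k^2\frac{L_k}{L_{k+1}}}$, $\quad\tau_k=\frac{1}{\alpha_{k+1}L_{k+1}}$; - $x_{k+1}=\tau_kz_k+(1-\tau_k)y_k$; - $h_{k+1}\in\operatorname{argmin}_{h\geq0}f(x_{k+1}-h\nabla f(x_{k+1}))$, $\quad y_{k+1}=x_{k+1}-h_{k+1}\nabla f(x_{k+1})$; - $z_{k+1}=z_k-\alpha_{k+1}\nabla f(x_{k+1})$; - if $\langle\alpha_{k+1}\nabla f(x_{k+1}),z_k-z_{k+1}\rangle-\frac12\|z_k-z_{k+1}\|^2\leq\alpha_{k+1}^2L_{k+1}\left(f(x_{k+1})-f(y_{k+1})+\frac{\tau_k\varepsilon}{2}\right)$, accept the current values of $L_{k+1},\alpha_{k+1},\tau_k,x_{k+1},y_{k+1},z_{k+1}$ and pass to the next $k$; otherwise replace $L_{k+1}$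 by $2L_{k+1}$ and repeat. All symbols $L_k,\alpha_k,x_k,y_k,z_k$ denote the accepted values. It is assumed that the exact line search is always possible, i.e. the minimizers $h_{k+1}$ exist. *)

(* Defs.v *)
From mathcomp Require Import all_boot all_order all_algebra.
From mathcomp Require Import all_classical all_reals all_analysis.

Set Implicit Arguments.
Unset Strict Implicit.
Unset Printing Implicit Defensive.

Import Order.TTheory GRing.Theory Num.Theory.
Import numFieldNormedType.Exports.
Local Open Scope classical_set_scope.
Local Open Scope ring_scope.

(* The canonical norm `|u| on 'rV[R]_n is the sup norm, hence the explicit
   Euclidean structure. *)
Definition dot (R : realType) (n : nat) (u v : 'rV[R]_n) : R :=
  \sum_(i < n) u 0 i * v 0 i.

Definition enorm (R : realType) (n : nat) (u : 'rV[R]_n) : R :=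
  Num.sqrt (dot u u).

Definition grad (R : realType) (n : nat) (f : 'rV[R]_n -> R) (x : 'rV[R]_n) :
  'rV[R]_n := \row_(i < n) 'D_(delta_mx 0 i) f x.

(* Since 0 `^ 0 = 1, the case nu = 0 is a bound on the variation of the
   gradient. *)
Definition holder_grad (R : realType) (n : nat) (f : 'rV[R]_n -> R)
    (nu M : R) : Prop :=
  forall x y, enorm (grad f x - grad f y) <= M * enorm (x - y) `^ nu.

Definition argmin_ray (R : realType) (n : nat) (f : 'rV[R]_n -> R)
    (x : 'rV[R]_n) (h : R) : Prop :=
  0 <= h /\
  forall h', 0 <= h' -> f (x - h *: grad f x) <= f (x - h' *: grad f x).

(* The values (L_k, alpha_k, x_k, y_k, z_k). *)
Record state (R : realType) (n : nat) := State {
  stL : R;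
  stalpha : R;
  stx : 'rV[R]_n;
  sty : 'rV[R]_n;
  stz : 'rV[R]_n }.

(* tau_k, as a function of the values of index k.+1 *)
Definition sttau (R : realType) (n : nat) (s' : state R n) : R :=
  1 / (stalpha s' * stL s').

(* Trial number i (counted from 0) of the iteration starting from s; the trial
   value of L is L_k / 2 doubled i times, and h is the step length returned by
   the line search. *)
Definition trial (R : realType) (n : nat) (f : 'rV[R]_n -> R) (s : state R n)
    (i : nat) (h : R) : state R n :=
  let L' := stL s / 2 * 2 ^+ i in
  let alpha' := 1 / (2 * L') +
    Num.sqrt (1 / (4 * L' ^+ 2) + stalpha s ^+ 2 * (stL s / L')) in
  let tau := 1 / (alpha' * L') in
  let x' := tau *: stz s + (1 - tau) *: sty s in
  State L' alpha' x'
    (x' - h *: grad f x')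
    (stz s - alpha' *: grad f x').

Definition accepts (R : realType) (n : nat) (f : 'rV[R]_n -> R) (eps : R)
    (s s' : state R n) : bool :=
  dot (stalpha s' *: grad f (stx s')) (stz s - stz s')
    - 1 / 2 * enorm (stz s - stz s') ^+ 2
  <= stalpha s' ^+ 2 * stL s' *
     (f (stx s') - f (sty s') + sttau s' * eps / 2).

(* Index of the first accepted trial, where h i is the step length of trial i.
   The default value 0 is used only if every trial is rejected, a situation
   that is not excluded by definition. *)
Definition first_accepted (R : realType) (n : nat) (f : 'rV[R]_n -> R)
    (eps : R) (s : state R n) (h : nat -> R) : nat :=
  xget 0%N [set i | accepts f eps s (trial f s i (h i)) /\
    forall j, (j < i)%N -> ~~ accepts f eps s (trial f s j (h j))].

(* Accepted values; h k i is the step length returned by the line search in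
   trial i of iteration k, and determines the run. *)
Fixpoint ulcm (R : realType) (n : nat) (f : 'rV[R]_n -> R) (L0 : R)
    (x0 : 'rV[R]_n) (eps : R) (h : nat -> nat -> R) (k : nat) : state R n :=
  if k is k'.+1 then
    let s := ulcm f L0 x0 eps h k' in
    let i := first_accepted f eps s (h k') in
    trial f s i (h k' i)
  else State L0 0 x0 x0 x0.

(* Every line search actually performed is exact: trial i of iteration k takes
   place only when all the previous ones were rejected. The point stx of a
   trial does not depend on its step length. *)
Definition exact_line_search (R : realType) (n : nat) (f : 'rV[R]_n -> R)
    (L0 : R) (x0 : 'rV[R]_n) (eps : R) (h : nat -> nat -> R) : Prop :=
  forall k i, let s := ulcm f L0 x0 eps h k in
  (forall j, (j < i)%N -> ~~ accepts f eps s (trial f s j (h k j))) ->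
  argmin_ray f (stx (trial f s i (h k i))) (h k i).

Definition Aseq (R : realType) (n : nat) (s : nat -> state R n) (m : nat) : R :=
  stalpha (s m) ^+ 2 * stL (s m).

Definition lin_model (R : realType) (n : nat) (f : 'rV[R]_n -> R)
    (s : nat -> state R n) (m : nat) (u : 'rV[R]_n) : R :=
  \sum_(1 <= i < m.+1) stalpha (s i) *
    (f (stx (s i)) + dot (grad f (stx (s i))) (u - stx (s i))).

Definition is_min (R : realType) (S : set R) (v : R) : Prop :=
  S v /\ lbound S v.

(* Main.v *)
Require Import Defs.
From mathcomp Require Import ring lra.
From mathcomp Require Import all_boot all_order all_algebra.
From mathcomp Require Import all_classical all_reals all_analysis.

Set Implicit Arguments.
Unset Strict Implicit.
Unset Printing Implicit Defensive.

Import Order.TTheory GRing.Theory Num.Theory.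
Import numFieldNormedType.Exports.
Local Open Scope classical_set_scope.
Local Open Scope ring_scope.


(** The run never stalls, and each accepted step obeys a potential inequality
    that telescopes.

    Write [g] for the gradient at the trial point and [A] for
    [alpha ^+ 2 * L]. Since [alpha] solves [alpha ^+ 2 * L = alpha + A_k],
    the weights satisfy [A_{k+1} = A_k + alpha_{k+1}]. The acceptance test
    amounts to
    [alpha ^+ 2 * |g| ^+ 2 / 2 <= A * (f x - f y) + alpha * eps / 2], which is
    the error term in the expansion of [|z_{k+1} - u| ^+ 2 / 2]; the coupling
    of [x] with [z_k] and [y_k] and convexity turn the remaining linear term
    into values of [f] at [y_k] ([accepted_step_estimate]). Summing
    ([ulcm_estimate]) gives
    [A_m * f y_m <= l_m u + A_m * eps / 2 + |z_0 - u| ^+ 2 / 2], and the upper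
    bound is the case where [u] minimizes the affine function [l_m] on the ball
    ([affine_min_on_ball]). The lower bound holds because [l_m <= A_m * f]
    ([lin_model_le]) and [xstar] lies in the ball.

    What has to be shown besides is that some trial is accepted
    ([first_accepted_accepts]): as [L] doubles, [alpha] tends to [0] while the
    trial points stay on the segment from [y_k] to [z_k], where the Hoelder
    condition bounds the gradient. A step of length [1 / L] then decreases [f]
    by [|g| ^+ 2 / L] up to a term of order [1 / L], whereas the test tolerates
    [eps / (2 * alpha * L)]. The crude bound [t `^ nu <= 1 + t] suffices, and so
    all [nu] in the unit interval are treated alike. *)

(** * Euclidean geometry of row vectors *)

Section Euclidean.
Variables (R : realType) (n : nat).
Implicit Types (u v w : 'rV[R]_n) (a : R).

Lemma dotC u v : dot u v = dot v u.
Proof. by apply: eq_bigr => i _; rewrite mulrC. Qed.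

Lemma dotDl u v w : dot (u + v) w = dot u w + dot v w.
Proof.
by rewrite /dot -big_split; apply: eq_bigr => i _; rewrite mxE mulrDl.
Qed.

Lemma dotZl a u v : dot (a *: u) v = a * dot u v.
Proof. by rewrite /dot mulr_sumr; apply: eq_bigr => i _; rewrite mxE mulrA. Qed.

Lemma dotNl u v : dot (- u) v = - dot u v.
Proof. by rewrite -scaleN1r dotZl mulN1r. Qed.

Lemma dotBl u v w : dot (u - v) w = dot u w - dot v w.
Proof. by rewrite dotDl dotNl. Qed.

Lemma dotDr u v w : dot u (v + w) = dot u v + dot u w.
Proof. by rewrite dotC dotDl !(dotC u). Qed.

Lemma dotZr a u v : dot u (a *: v) = a * dot u v.
Proof. by rewrite dotC dotZl dotC. Qed.

Lemma dotNr u v : dot u (- v) = - dot u v.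
Proof. by rewrite dotC dotNl dotC. Qed.

Lemma dotBr u v w : dot u (v - w) = dot u v - dot u w.
Proof. by rewrite dotDr dotNr. Qed.

Lemma dot0l v : dot 0 v = 0.
Proof. by rewrite -(scale0r 0) dotZl mul0r. Qed.

Lemma dot_suml (I : Type) (r : seq I) (P : pred I) (F : I -> 'rV[R]_n) v :
  dot (\sum_(i <- r | P i) F i) v = \sum_(i <- r | P i) dot (F i) v.
Proof.
by elim/big_rec2: _ => [|i x y _ <-]; rewrite ?dot0l ?dotDl.
Qed.

Lemma dot_ge0 u : 0 <= dot u u.
Proof. by apply: sumr_ge0 => i _; rewrite -expr2 sqr_ge0. Qed.

Lemma enorm_sq u : enorm u ^+ 2 = dot u u.
Proof. by rewrite sqr_sqrtr // dot_ge0. Qed.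

Lemma enorm_ge0 u : 0 <= enorm u.
Proof. exact: sqrtr_ge0. Qed.

Lemma enorm0_eq0 u : enorm u = 0 -> u = 0.
Proof.
move=> u0; have : dot u u = 0 by rewrite -enorm_sq u0 expr0n.
move=> /psumr_eq0P u0'; apply/rowP => i; rewrite mxE.
have /eqP := u0' (fun j _ => ltac:(rewrite -expr2; exact: sqr_ge0)) i isT.
by rewrite mulf_eq0 orbb => /eqP.
Qed.

Lemma enormZ a u : enorm (a *: u) = `|a| * enorm u.
Proof.
by rewrite /enorm dotZl dotZr mulrA -expr2 sqrtrM ?sqr_ge0// sqrtr_sqr.
Qed.

(** Expanding the square of the norm of [|v| u - |u| v] gives
    [2 |u| |v| (|u| |v| - <u, v>)]. *)
Lemma cauchy_schwarz u v : dot u v <= enorm u * enorm v.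
Proof.
have [/enorm0_eq0 ->|u0] := eqVneq (enorm u) 0.
  by rewrite dot0l mulr_ge0// enorm_ge0.
have [/enorm0_eq0 ->|v0] := eqVneq (enorm v) 0.
  by rewrite dotC dot0l mulr_ge0// enorm_ge0.
have uv : 0 < enorm u * enorm v by rewrite mulr_gt0// lt0r enorm_ge0 ?u0 ?v0.
have := dot_ge0 (enorm v *: u - enorm u *: v).
rewrite !(dotBl, dotBr, dotZl, dotZr) -!enorm_sq (dotC v u) => H.
rewrite -subr_ge0 -(pmulr_rge0 _ uv); lra.
Qed.

Lemma enormD u v : enorm (u + v) <= enorm u + enorm v.
Proof.
rewrite -(@ler_pXn2r _ 2)// ?nnegrE ?addr_ge0 ?enorm_ge0//.
rewrite enorm_sq !(dotDl, dotDr) (dotC v u) sqrrD !enorm_sq.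
by have := cauchy_schwarz u v; lra.
Qed.

(** The minimum is attained where the ball meets the ray of direction [- g]; for
    [g = 0] the quotient below is [0] and the centre is a minimizer. *)
Lemma affine_min_on_ball (c : R) (g z : 'rV[R]_n) (Theta : R) : 0 <= Theta ->
  exists2 u : 'rV[R]_n, 1 / 2 * enorm (z - u) ^+ 2 <= Theta &
    forall v, 1 / 2 * enorm (z - v) ^+ 2 <= Theta ->
      c + dot g u <= c + dot g v.
Proof.
move=> Th0; set r := Num.sqrt (2 * Theta).
have r0 : 0 <= r by exact: sqrtr_ge0.
have r2 : r ^+ 2 = 2 * Theta by rewrite sqr_sqrtr// mulr_ge0.
exists (z - (r / enorm g) *: g).
  rewrite opprB addrCA subrr addr0 enormZ exprMn real_normK ?num_real//.
  have [->|g0] := eqVneq (enorm g) 0; first by rewrite expr0n !mulr0.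
  by rewrite -exprMn divfK// r2; lra.
move=> v hv.
have zv : enorm (z - v) <= r.
  by rewrite -(@ler_pXn2r _ 2)// ?nnegrE ?enorm_ge0// r2; lra.
rewrite lerD2l dotBr dotZr -enorm_sq.
have -> : r / enorm g * enorm g ^+ 2 = r * enorm g.
  have [->|g0] := eqVneq (enorm g) 0; first by rewrite expr0n !mulr0.
  by rewrite expr2 mulrA divfK.
have := cauchy_schwarz g (z - v); rewrite dotBr => cs.
have := ler_wpM2l (enorm_ge0 g) zv; lra.
Qed.

End Euclidean.

(** * Gradient inequalities *)

Section Gradient.
Variables (R : realType) (n : nat) (f : 'rV[R]_n -> R).
Hypothesis f_diff : forall x : 'rV[R]_n, differentiable f x.

Lemma derive_dot (x v : 'rV[R]_n) : 'D_v f x = dot (grad f x) v.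
Proof.
rewrite deriveE// {1}(row_sum_delta v) linear_sum; apply: eq_bigr => i _.
by rewrite linearZ mxE deriveE// mulrC.
Qed.

Hypothesis f_convex : convex_function [set: 'rV[R]_n] f.

Lemma convex_segment (x y : 'rV[R]_n) (t : R) : 0 <= t -> t <= 1 ->
  f (t *: x + (1 - t) *: y) <= t * f x + (1 - t) * f y.
Proof.
move=> t0 t1.
exact: (@f_convex (Itv01 t0 t1) x y (mem_set I) (mem_set I)).
Qed.

(** The slopes of a convex function along the segment from [x] to [y] are at
    most [f y - f x]; so is their limit at [x]. *)
Lemma convex_gradient_le (x y : 'rV[R]_n) :
  f x + dot (grad f x) (y - x) <= f y.
Proof.
rewrite -lerBrDl -derive_dot.
have slope_cvg : t^-1 *: (f (t *: (y - x) + x) - f x) @[t --> 0^'] -->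
    'D_(y - x) f x by exact: diff_derivable.
apply: (cvgr_to_le (cvg_dnbhs_at_right slope_cvg)).
near=> t.
have t0 : 0 < t by near: t; exact: nbhs_right_gt.
have t1 : t <= 1 by near: t; exact: nbhs_right_le.
rewrite /= /GRing.scale/= mulrC ler_pdivrMr// lerBlDr.
have -> : t *: (y - x) + x = t *: y + (1 - t) *: x.
  by rewrite scalerBr scalerBl scale1r addrAC -addrA.
apply: (le_trans (convex_segment _ _ (ltW t0) t1)); lra.
Unshelve. all: by end_near. Qed.

Variables (nu M : R).
Hypotheses (nu_ge0 : 0 <= nu) (nu_le1 : nu <= 1) (M_ge0 : 0 <= M).
Hypothesis f_holder : holder_grad f nu M.

Lemma powR_le_1D (t : R) : 0 <= t -> t `^ nu <= 1 + t.
Proof.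
move=> t0; have [t1|/ltW t1] := leP t 1.
  apply: (@le_trans _ _ 1); last by rewrite lerDl.
  have := ge0_ler_powR nu_ge0 _ _ t1; rewrite powR1; apply.
    by rewrite nnegrE.
  by rewrite nnegrE ler01.
by apply: (le_trans (ler1_powR t1 nu_le1)); rewrite lerDr.
Qed.

Lemma grad_variation_le (x y : 'rV[R]_n) :
  enorm (grad f x - grad f y) <= M * (1 + enorm (x - y)).
Proof.
by apply: (le_trans (f_holder x y)); rewrite ler_wpM2l// powR_le_1D// enorm_ge0.
Qed.

(** By convexity at the endpoint [w := x - t *: grad f x], the decrease is at
    least [t * dot (grad f w) (grad f x)], and [grad f w] differs from
    [grad f x] by at most [M * (1 + G)]. *)
Lemma gradient_step_decrease (x : 'rV[R]_n) (t G : R) :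
  0 <= t -> t <= 1 -> enorm (grad f x) <= G ->
  f (x - t *: grad f x) <=
    f x - t * dot (grad f x) (grad f x) + t * (G * (M * (1 + G))).
Proof.
move=> t0 t1 gG; set g := grad f x; set w := x - t *: g.
have cw := convex_gradient_le w x.
rewrite (_ : x - w = t *: g) ?dotZr in cw; last first.
  by rewrite opprB addrCA subrr addr0.
have G0 : 0 <= G by exact: le_trans (enorm_ge0 _) gG.
have vw : enorm (g - grad f w) <= M * (1 + G).
  apply: (le_trans (grad_variation_le x w)).
  rewrite ler_wpM2l// lerD2l opprB addrCA subrr addr0 enormZ ger0_norm//.
  by apply: le_trans gG; rewrite ler_piMl// enorm_ge0.
have cs : dot (g - grad f w) g <= G * (M * (1 + G)).
  apply: (le_trans (cauchy_schwarz _ _)).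
  by rewrite mulrC ler_pM// enorm_ge0.
have := ler_wpM2l t0 cs; rewrite dotBl; lra.
Qed.

End Gradient.

(** * One iteration of the method *)

Section Trial.
Variables (R : realType) (n : nat) (f : 'rV[R]_n -> R) (eps : R).
Variable s : state R n.
Hypothesis L_gt0 : 0 < stL s.

Lemma trial_L_gt0 i h : 0 < stL (trial f s i h).
Proof. by rewrite /= mulr_gt0// ?divr_gt0// exprn_gt0. Qed.

Lemma trial_alpha_gt0 i h : 0 < stalpha (trial f s i h).
Proof.
have := trial_L_gt0 i h; rewrite /= => L0.
by rewrite ltr_wpDr ?sqrtr_ge0// divr_gt0// mulr_gt0.
Qed.

(** The step [alpha_{k+1}] is the positive root of
    [alpha ^+ 2 * L_{k+1} = alpha + alpha_k ^+ 2 * L_k]. *)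
Lemma trial_alpha_sq i h : stalpha (trial f s i h) ^+ 2 * stL (trial f s i h) =
  stalpha (trial f s i h) + stalpha s ^+ 2 * stL s.
Proof.
have := trial_L_gt0 i h; rewrite /=; set L := _ * 2 ^+ i => L0.
set D := 1 / (4 * _) + _; have D0 : 0 <= D.
  apply: addr_ge0.
    by apply: divr_ge0 => //; apply: mulr_ge0 => //; exact: sqr_ge0.
  by rewrite mulr_ge0 ?sqr_ge0// divr_ge0// ltW.
have := sqr_sqrtr D0; set r := Num.sqrt D => rD.
rewrite sqrrD rD /D; field; lra.
Qed.

Lemma trial_alphaL_ge1 i h :
  1 <= stalpha (trial f s i h) * stL (trial f s i h).
Proof.
rewrite -(ler_pM2l (trial_alpha_gt0 i h)) mulr1 mulrA -expr2 trial_alpha_sq.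
by rewrite lerDl mulr_ge0 ?sqr_ge0 ?ltW.
Qed.

(** With [A] the current [alpha_k ^+ 2 * L_k], which does not depend on the
    trial: were [alpha > delta], the equation for [alpha] would give
    [L = 1 / alpha + A / alpha ^+ 2 < 1 / delta + A / delta ^+ 2]. *)
Lemma trial_alpha_small (h : nat -> R) (delta : R) : 0 < delta ->
  exists i, 1 <= stL (trial f s i (h i)) /\
            stalpha (trial f s i (h i)) <= delta.
Proof.
move=> d0; set A := stalpha s ^+ 2 * stL s.
have A0 : 0 <= A by rewrite mulr_ge0 ?sqr_ge0 ?ltW.
(* The summand [1] is there for the bound [1 <= L]. *)
pose B := 1 + 1 / delta + A / delta ^+ 2.
have dB : 0 <= 1 / delta by rewrite divr_ge0// ltW.
have AB : 0 <= A / delta ^+ 2 by rewrite divr_ge0// sqr_ge0.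
exists (Num.Def.archi_bound (B / (stL s / 2))); set i := Num.Def.archi_bound _.
have LB : B < stL (trial f s i (h i)).
  by rewrite /= mulrC -ltr_pdivrMr ?divr_gt0// upper_nthrootP.
have eqA := trial_alpha_sq i (h i); rewrite -/A in eqA.
have aP := trial_alpha_gt0 i (h i).
move: LB eqA aP; set a := stalpha _; set L := stL (trial _ _ _ _) => LB eqA aP.
split; first by rewrite /B in LB; lra.
rewrite leNgt; apply/negP => da.
have : a ^+ 2 * L < a ^+ 2 * L; last by rewrite ltxx.
rewrite {1}eqA; have h1 : a <= a ^+ 2 * (1 / delta).
  rewrite expr2 -mulrA ler_peMr ?(ltW aP)// mulrA mulr1.
  by rewrite ler_pdivlMr// mul1r ltW.
have h2 : A <= a ^+ 2 * (A / delta ^+ 2).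
  rewrite mulrCA ler_peMr// ler_pdivlMr ?exprn_gt0// mul1r.
  by rewrite ler_pXn2r ?nnegrE ?(ltW aP) ?(ltW d0)// ltW.
have h3 : a ^+ 2 * B < a ^+ 2 * L by rewrite ltr_pM2l// exprn_gt0.
have a2 : 0 < a ^+ 2 by rewrite exprn_gt0.
rewrite /B in h3; lra.
Qed.

(** Since [z_k - z_{k+1} = alpha * g] and [tau * (alpha ^+ 2 * L) = alpha], the
    acceptance test bounds the squared gradient by the decrease of the line
    search, up to [alpha * eps / 2]. *)
Lemma trial_acceptsE i h : let s' := trial f s i h in
  let g := grad f (stx s') in
  accepts f eps s s' =
    (1 / 2 * (stalpha s' ^+ 2 * dot g g)
     <= stalpha s' ^+ 2 * stL s' * (f (stx s') - f (sty s'))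
        + stalpha s' * eps / 2).
Proof.
move=> s' g; have a0 := trial_alpha_gt0 i h; have L0 := trial_L_gt0 i h.
have zE : stz s - stz s' = stalpha s' *: g by rewrite opprB addrCA subrr addr0.
rewrite /accepts zE enorm_sq !dotZl dotZr /sttau -/g.
rewrite -/s' in a0 L0; move: (stalpha s') (stL s') a0 L0 => a L a0 L0.
congr (_ <= _); first by field.
by field; rewrite !gt_eqF.
Qed.

(** The trial point is a convex combination of [z_k] and [y_k], with weights
    proportional to [alpha] and [A_k]; paired with [g] this moves the linear
    term from [z_k] to [y_k]. *)
Lemma trial_coupling i h (g : 'rV[R]_n) : let s' := trial f s i h in
  stalpha s' * dot g (stz s - stx s') =
  - (stalpha s ^+ 2 * stL s * dot g (sty s - stx s')).
Proof.
move=> s'; have a0 := trial_alpha_gt0 i h; have L0 := trial_L_gt0 i h.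
have aE := trial_alpha_sq i h; rewrite -/s' in a0 L0 aE.
have -> : stalpha s ^+ 2 * stL s = stalpha s' ^+ 2 * stL s' - stalpha s'.
  by rewrite aE addrAC subrr add0r.
have -> : stx s' = sttau s' *: stz s + (1 - sttau s') *: sty s by [].
rewrite !(dotBr, dotDr, dotZr) /sttau.
by field; rewrite !gt_eqF.
Qed.

(** The weight of [z_k] is [1 / (alpha * L) <= 1]. *)
Lemma trial_x_dist i h :
  enorm (stx (trial f s i h) - sty s) <= enorm (stz s - sty s).
Proof.
have aL := trial_alphaL_ge1 i h; set s' := trial f s i h in aL *.
have -> : stx s' - sty s = sttau s' *: (stz s - sty s).
  have -> : stx s' = sttau s' *: stz s + (1 - sttau s') *: sty s by [].
  by rewrite scalerBl scale1r scalerBr addrCA -addrA addrC subrK.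
have aL0 : 0 < stalpha s' * stL s' by exact: lt_le_trans aL.
rewrite enormZ ger0_norm ?divr_ge0 ?(ltW aL0)//.
by rewrite ler_piMl ?enorm_ge0// ler_pdivrMr// mul1r.
Qed.

Hypothesis f_diff : forall x : 'rV[R]_n, differentiable f x.
Hypothesis f_convex : convex_function [set: 'rV[R]_n] f.

(** The estimate of one accepted step, with potential
    [A_k * f y_k + 1 / 2 * |z_k - u| ^+ 2]. Expanding [|z_{k+1} - u| ^+ 2]
    produces the squared gradient, which the acceptance test controls, and the
    linear term, which the coupling splits between the model at [u] and the
    gradient inequality at [y_k]. *)
Lemma accepted_step_estimate i h (u : 'rV[R]_n) : let s' := trial f s i h in
  accepts f eps s s' ->
  stalpha s' ^+ 2 * stL s' * f (sty s') + 1 / 2 * enorm (stz s' - u) ^+ 2 <=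
  stalpha s ^+ 2 * stL s * f (sty s) + 1 / 2 * enorm (stz s - u) ^+ 2
  + stalpha s' * (f (stx s') + dot (grad f (stx s')) (u - stx s'))
  + stalpha s' * eps / 2.
Proof.
move=> s'; rewrite trial_acceptsE -/s'; set g := grad f (stx s') => acc.
have aE := trial_alpha_sq i h.
have cpl : stalpha s' * dot g (stz s - stx s') =
  - (stalpha s ^+ 2 * stL s * dot g (sty s - stx s')) := trial_coupling i h g.
have cvx := convex_gradient_le f_diff f_convex (stx s') (sty s).
rewrite -/s' in aE; rewrite -/g in cvx.
have A0 : 0 <= stalpha s ^+ 2 * stL s by rewrite mulr_ge0 ?sqr_ge0 ?ltW.
have : stalpha s ^+ 2 * stL s * dot g (sty s - stx s') <=
       stalpha s ^+ 2 * stL s * (f (sty s) - f (stx s')).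
  by rewrite ler_wpM2l// lerBrDl.
have -> : stz s' - u = (stz s - u) - stalpha s' *: g by rewrite addrAC.
have -> : u - stx s' = (stz s - stx s') - (stz s - u).
  by rewrite opprB [RHS]addrC addrA subrK.
move: cpl acc; rewrite !aE !enorm_sq.
move: (stz s - u) (stz s - stx s') (sty s - stx s') => w d e.
rewrite !(dotBl, dotBr, dotZl, dotZr) (dotC w g).
move: (dot g d) (dot g e) (dot g w) (dot w w) (dot g g) => p q gw ww gg.
move: (stalpha s ^+ 2 * stL s) => A.
move: (stalpha s') => a.
move: (f (sty s)) (f (stx s')) (f (sty s')) => fy fx fy'.
lra.
Qed.

Variables (nu M : R).
Hypotheses (nu_ge0 : 0 <= nu) (nu_le1 : nu <= 1) (M_ge0 : 0 <= M).
Hypothesis f_holder : holder_grad f nu M.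

Lemma trial_grad_le i h : enorm (grad f (stx (trial f s i h))) <=
  M * (1 + enorm (stz s - sty s)) + enorm (grad f (sty s)).
Proof.
rewrite -{1}(subrK (grad f (sty s)) (grad f (stx _))).
apply: (le_trans (enormD _ _)); rewrite lerD2r.
apply: (le_trans (grad_variation_le nu_ge0 nu_le1 M_ge0 f_holder _ _)).
by rewrite ler_wpM2l// lerD2l trial_x_dist.
Qed.

(** The step of length [1 / L] decreases [f] by [dot g g / L] up to
    [G * (M * (1 + G)) / L], where [G] bounds the gradient at every trial point;
    the exact line search does no worse. The tolerance of the test, divided by
    [alpha ^+ 2 * L], is [eps / (2 * alpha * L)], which prevails for [alpha]
    small. *)
Lemma trial_accepted i h : let s' := trial f s i h in
  let G := M * (1 + enorm (stz s - sty s)) + enorm (grad f (sty s)) in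
  argmin_ray f (stx s') h -> 1 <= stL s' ->
  stalpha s' * (G * (M * (1 + G))) <= eps / 2 ->
  accepts f eps s s'.
Proof.
move=> s' G [_ hmin] L1 aG; rewrite trial_acceptsE -/s'.
have gG := trial_grad_le i h; rewrite -/s' -/G in gG.
have a0 : 0 < stalpha s' := trial_alpha_gt0 i h.
have L0 : 0 < stL s' := trial_L_gt0 i h.
have Li0 : 0 <= (stL s')^-1 by rewrite invr_ge0 ltW.
have Li1 : (stL s')^-1 <= 1 by rewrite invf_le1.
have dec := gradient_step_decrease f_diff f_convex nu_ge0 nu_le1 M_ge0 f_holder
  Li0 Li1 gG.
have := le_trans (hmin _ Li0) dec.
have -> : stx s' - h *: grad f (stx s') = sty s' by [].
set g := grad f _; have := dot_ge0 g.
move: (dot g g) (G * (M * (1 + G))) aG => gg K aK gg0 fy.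
have aL0 : 0 <= stalpha s' ^+ 2 * stL s' by rewrite mulr_ge0 ?sqr_ge0 ?ltW.
have fd : (stL s')^-1 * gg - (stL s')^-1 * K <= f (stx s') - f (sty s') by lra.
have := ler_wpM2l aL0 fd.
have -> : stalpha s' ^+ 2 * stL s' * ((stL s')^-1 * gg - (stL s')^-1 * K) =
   stalpha s' ^+ 2 * gg - stalpha s' * (stalpha s' * K).
  by field; rewrite gt_eqF.
have := ler_wpM2l (ltW a0) aK.
have : 0 <= stalpha s' ^+ 2 * gg by rewrite mulr_ge0// sqr_ge0.
lra.
Qed.

(** Were every trial rejected, every line search would be exact, and a trial
    with [alpha] small enough would be accepted. *)
Lemma first_accepted_accepts (h : nat -> R) : 0 < eps ->
  (forall i, (forall j, (j < i)%N -> ~~ accepts f eps s (trial f s j (h j))) ->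
    argmin_ray f (stx (trial f s i (h i))) (h i)) ->
  let i := first_accepted f eps s h in accepts f eps s (trial f s i (h i)).
Proof.
move=> eps0 exact_h.
have ex_acc : exists i, accepts f eps s (trial f s i (h i)).
  apply: contrapT => none.
  have rej j : ~~ accepts f eps s (trial f s j (h j)).
    by apply/negP => acc; apply: none; exists j.
  pose G := M * (1 + enorm (stz s - sty s)) + enorm (grad f (sty s)).
  have G0 : 0 <= G by rewrite addr_ge0 ?mulr_ge0 ?addr_ge0 ?enorm_ge0.
  have K0 : 0 <= G * (M * (1 + G)) by rewrite !mulr_ge0// addr_ge0.
  have d0 : 0 < eps / 2 / (1 + G * (M * (1 + G))).
    by rewrite !divr_gt0// ltr_pwDl.
  have [i [L1 ad]] := trial_alpha_small h d0.
  apply: none; exists i; apply: trial_accepted => //; first exact: exact_h.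
  rewrite -/G; move: ad; rewrite ler_pdivlMr ?ltr_pwDl// mulrDr mulr1.
  have := trial_alpha_gt0 i (h i); lra.
pose i0 := ex_minn ex_acc.
have first_i0 : accepts f eps s (trial f s i0 (h i0)) /\
    forall j, (j < i0)%N -> ~~ accepts f eps s (trial f s j (h j)).
  rewrite /i0; case: ex_minnP => i acc_i min_i; split=> // j ji.
  by apply/negP => /min_i; rewrite leqNgt ji.
rewrite /first_accepted.
by case: xgetP => [i _ []|/(_ i0 first_i0)].
Qed.

End Trial.

(** * The whole run *)

Section Run.
Variables (R : realType) (n : nat) (f : 'rV[R]_n -> R).
Variables (L0 eps : R) (x0 : 'rV[R]_n) (h : nat -> nat -> R).
Hypothesis L0_gt0 : 0 < L0.
Local Notation s := (ulcm f L0 x0 eps h).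

Lemma ulcm_L_gt0 k : 0 < stL (s k).
Proof. by elim: k => // k IH; exact: trial_L_gt0. Qed.

Lemma ulcm_alpha_gt0 k : 0 < stalpha (s k.+1).
Proof. exact: trial_alpha_gt0 (ulcm_L_gt0 k) _ _. Qed.

Lemma ulcm_alpha_ge0 k : 0 <= stalpha (s k).
Proof. by case: k => // k; exact/ltW/ulcm_alpha_gt0. Qed.

Lemma AseqS m : Aseq s m.+1 = Aseq s m + stalpha (s m.+1).
Proof. by rewrite addrC; exact: trial_alpha_sq (ulcm_L_gt0 m) _ _. Qed.

Lemma lin_modelS m u : lin_model f s m.+1 u =
  lin_model f s m u + stalpha (s m.+1) *
    (f (stx (s m.+1)) + dot (grad f (stx (s m.+1))) (u - stx (s m.+1))).
Proof. by rewrite /lin_model big_nat_recr. Qed.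

Lemma Aseq_sum m : Aseq s m = \sum_(1 <= i < m.+1) stalpha (s i).
Proof.
elim: m => [|m IH]; first by rewrite /Aseq/= big_geq// expr0n mul0r.
by rewrite big_nat_recr// -IH AseqS.
Qed.

Lemma Aseq_gt0 m : (1 <= m)%N -> 0 < Aseq s m.
Proof.
case: m => // m _.
by rewrite mulr_gt0 ?exprn_gt0 ?ulcm_alpha_gt0 ?ulcm_L_gt0.
Qed.

Lemma lin_model_affine m : exists (c : R) (g : 'rV[R]_n),
  forall u, lin_model f s m u = c + dot g u.
Proof.
exists (\sum_(1 <= i < m.+1) stalpha (s i) *
         (f (stx (s i)) - dot (grad f (stx (s i))) (stx (s i)))).
exists (\sum_(1 <= i < m.+1) stalpha (s i) *: grad f (stx (s i))) => u.
rewrite dot_suml -big_split; apply: eq_bigr => i _ /=.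
by rewrite dotZl dotBr; ring.
Qed.

Hypothesis f_diff : forall x : 'rV[R]_n, differentiable f x.
Hypothesis f_convex : convex_function [set: 'rV[R]_n] f.

(** Each term is [alpha_i] times a minorant of [f], and the weights sum to
    [A_m]. *)
Lemma lin_model_le m u : lin_model f s m u <= Aseq s m * f u.
Proof.
rewrite Aseq_sum mulr_suml; apply: ler_sum => i _.
by rewrite ler_wpM2l ?ulcm_alpha_ge0 ?convex_gradient_le.
Qed.

Variables (nu M : R).
Hypotheses (nu_ge0 : 0 <= nu) (nu_le1 : nu <= 1) (M_ge0 : 0 <= M).
Hypothesis f_holder : holder_grad f nu M.
Hypothesis eps_gt0 : 0 < eps.
Hypothesis h_exact : exact_line_search f L0 x0 eps h.

Lemma ulcm_accepts k : accepts f eps (s k) (s k.+1).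
Proof.
exact: (first_accepted_accepts (ulcm_L_gt0 k) f_diff f_convex
  nu_ge0 nu_le1 M_ge0 f_holder eps_gt0 (@h_exact k)).
Qed.

(** The potential inequality summed over the run; [A_0 = 0] removes the initial
    value of [f]. *)
Lemma ulcm_estimate m u :
  Aseq s m * f (sty (s m)) + 1 / 2 * enorm (stz (s m) - u) ^+ 2 <=
  lin_model f s m u + Aseq s m * (eps / 2)
  + 1 / 2 * enorm (stz (s 0%N) - u) ^+ 2.
Proof.
elim: m => [|m IH].
  by rewrite /Aseq /lin_model /= big_geq// expr0n !mul0r !add0r.
have step : Aseq s m.+1 * f (sty (s m.+1))
    + 1 / 2 * enorm (stz (s m.+1) - u) ^+ 2 <=
    Aseq s m * f (sty (s m)) + 1 / 2 * enorm (stz (s m) - u) ^+ 2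
    + stalpha (s m.+1) * (f (stx (s m.+1))
        + dot (grad f (stx (s m.+1))) (u - stx (s m.+1)))
    + stalpha (s m.+1) * eps / 2.
  exact: (accepted_step_estimate (ulcm_L_gt0 m) f_diff f_convex u
    (ulcm_accepts m)).
apply: (le_trans step); rewrite lin_modelS [in X in _ <= X]AseqS.
move: (s m.+1) (s m) (s 0%N) (Aseq s m) IH => s1 sm s0 A.
move: (enorm (stz sm - u)) (enorm (stz s0 - u)) => a b; lra.
Qed.

End Run.

Theorem mainTheorem2 (R : realType) (n : nat) (f : 'rV[R]_n -> R)
    (xstar : 'rV[R]_n) (nu M eps L0 Theta : R) (x0 : 'rV[R]_n)
    (h : nat -> nat -> R)
    (f_convex : convex_function [set: 'rV[R]_n] f)
    (f_diff : forall x : 'rV[R]_n, differentiable f x)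
    (xstar_min : forall x : 'rV[R]_n, f xstar <= f x)
    (nu_ge0 : 0 <= nu) (nu_le1 : nu <= 1) (M_ge0 : 0 <= M)
    (f_holder : holder_grad f nu M)
    (eps_gt0 : 0 < eps) (L0_gt0 : 0 < L0)
    (Theta_ge : 1 / 2 * enorm (x0 - xstar) ^+ 2 <= Theta)
    (h_exact : exact_line_search f L0 x0 eps h) :
  let s := ulcm f L0 x0 eps h in
  forall m : nat, (1 <= m)%N ->
  exists2 fhat : R,
    is_min [set 1 / Aseq s m * lin_model f s m u | u in
             [set u | 1 / 2 * enorm (stz (s 0%N) - u) ^+ 2 <= Theta]] fhat &
    f (sty (s m)) - f xstar <= f (sty (s m)) - fhat /\
    f (sty (s m)) - fhat <= eps / 2 + Theta / Aseq s m.
Proof.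
move=> s m m1.
have A0 : 0 < Aseq s m by exact: Aseq_gt0.
have Th0 : 0 <= Theta by apply: le_trans Theta_ge; rewrite mulr_ge0// sqr_ge0.
have [c [g modelE]] := lin_model_affine f L0 eps x0 h m.
have [u uB umin] := affine_min_on_ball c g (stz (s 0%N)) Th0.
exists (1 / Aseq s m * lin_model f s m u).
  split; first by exists u.
  move=> _ [v vB <-]; rewrite ler_wpM2l ?divr_ge0 ?(ltW A0)// !modelE.
  exact: umin.
have leE (a b : R) : (1 / Aseq s m * a <= b) = (a <= Aseq s m * b).
  by rewrite div1r mulrC ler_pdivrMr// mulrC.
split.
  have modelstar : lin_model f s m xstar <= Aseq s m * f xstar.
    exact: lin_model_le.
  rewrite lerD2l lerN2 leE; apply: le_trans modelstar.
  by rewrite !modelE; exact: umin.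
rewrite lerBlDr.
rewrite -(ler_pM2l A0) !mulrDr !mulrA.
have -> : Aseq s m * Theta / Aseq s m = Theta by field; rewrite gt_eqF.
have -> : Aseq s m * 1 / Aseq s m * lin_model f s m u = lin_model f s m u.
  by field; rewrite gt_eqF.
have := ulcm_estimate L0_gt0 f_diff f_convex nu_ge0 nu_le1 M_ge0 f_holder
  eps_gt0 h_exact m u.
rewrite -/s; have := sqr_ge0 (enorm (stz (s m) - u)); lra.
Qed.
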